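(* Let $N,k$ be non-negative integers and $l$ a positive integer, and let $Q_{k,l}(m,n)=(m+n)l+k\frac{n(n-1)}{2}+(n-1)mk+(k+1)\frac{m(m+1)}{2}$. Then \begin{align*} \sum_{\pi\in\mathcal{UG}_{k,l,N}}x^{\#(\pi)}q^{|\pi|}=&\sum_{m,n\geq 0}x^{m+n}q^{Q_{k,l}(m,n)}{N-(l+(n-1)k+m(k+1))+m \brack m}_q{N-(l+(n-1)k)-km+\lfloor n/2\rfloor \brack \lfloor n/2\rfloor}_{q^2}\\ &+\chi(0\le N<l-k). \end{align*}
   Context: A partition is a finite non-decreasing sequence $\pi=(\lambda_1,\dots,\lambda_{\#(\pi)})$ of positive integers (the empty sequence is the unique partition of $0$); $\#(\pi)$ is its number of parts and $|\pi|$ the sum of its parts. $\mathcal{UG}_{k,l,N}$ is the set of partitions with $\lambda_1\ge l$, $\lambda_i-\lambda_{i-1}\ge k$ for $2\le i\le\#(\pi)$, and all parts $\le N$ (the empty partition belongs to it). For integers $A,B$ and base $p$, ${A\brack B}_p=\frac{(p;p)_A}{(p;p)_B(p;p)_{A-B}}$ if $0\le B\le A$ and $0$ otherwise, where $(a;p)_j=\prod_{i=0}^{j-1}(1-ap^i)$. $\chi(S)=1$ if statement $S$ is true and $0$ otherwise. *)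

(* Defs.v *)
From mathcomp Require Import all_boot all_order all_algebra.

Set Implicit Arguments.
Unset Strict Implicit.
Unset Printing Implicit Defensive.

Import Order.TTheory GRing.Theory Num.Theory.
Local Open Scope ring_scope.

(* Generating functions are formal: q is the indeterminate of the field Q(q)
   and x is the variable of power series over Q(q). *)
Definition ratfun : fieldType := {fraction {poly rat}}.
Definition qvar : ratfun := tofrac ('X : {poly rat}).

Definition fps (R : nzRingType) := nat -> R.

Definition fps_monomial (R : nzRingType) (c : R) (d : nat) : fps R :=
  fun j => if j == d then c else 0.

Definition fps_add (R : nzRingType) (S T : fps R) : fps R :=
  fun j => S j + T j.

(* The family (f i), i in D, is summable with sum S: for each power of x only
   finitely many members contribute, and S collects their coefficients. When
   k = 0 both sides of the theorem can have infinitely many nonzero terms. *)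
Definition fps_sum (R : nzRingType) (I : eqType) (D : pred I)
    (f : I -> fps R) (S : fps R) : Prop :=
  forall j : nat, exists s : seq I,
    [/\ uniq s, all D s,
        forall i, D i -> i \notin s -> f i j = 0
      & S j = \sum_(i <- s) f i j].

Lemma fps_sum_unique (R : nzRingType) (I : eqType) (D : pred I)
    (f : I -> fps R) (S T : fps R) :
  fps_sum D f S -> fps_sum D f T -> S =1 T.
Proof.
move=> hS hT j.
have [s [us /allP Ds s0 ->]] := hS j; have [t [ut /allP Dt t0 ->]] := hT j.
rewrite (bigID (mem t)) /= [X in _ + X]big1_seq ?addr0; last first.
  by move=> i /andP[it /Ds Di]; apply: t0.
rewrite [RHS](bigID (mem s)) /= [X in _ + X]big1_seq ?addr0; last first.
  by move=> i /andP[it /Dt Di]; apply: s0.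
have st : perm_eq [seq i <- s | mem t i] [seq i <- t | mem s i].
  apply: uniq_perm; rewrite ?filter_uniq //.
  by move=> i; rewrite !mem_filter andbC.
by rewrite -[LHS]big_filter -[RHS]big_filter (perm_big _ st).
Qed.

Definition is_partition (pi : seq nat) : bool :=
  sorted leq pi && all (fun a => 0 < a)%N pi.

Definition UG (k l N : nat) (pi : seq nat) : bool :=
  [&& is_partition pi,
      (pi != [::]) ==> (l <= head 0 pi)%N,
      sorted (fun a b => a + k <= b)%N pi
    & all (fun a => a <= N)%N pi].

Definition qpoch (F : fieldType) (a p : F) (j : nat) : F :=
  \prod_(i < j) (1 - a * p ^+ i).

Definition qbinom (F : fieldType) (p : F) (A B : int) : F :=
  if 0 <= B <= A then
    qpoch p p `|A|%N / (qpoch p p `|B|%N * qpoch p p `|(A - B)%R|%N)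
  else 0.

Definition Qexp (k l m n : int) : int :=
  (m + n) * l + k * ((n * (n - 1)) %/ 2)%Z + (n - 1) * m * k
  + (k + 1) * ((m * (m + 1)) %/ 2)%Z.

(* Main.v *)
(* Fix the number [j] of parts and put [M = N - l - (j - 1) k]. Subtracting the
   minimal partition [l, l + k, ..., l + (j - 1) k] turns the left-hand side
   into a power of q times the Gauss binomial [M + j choose j]_q. On the right,
   up to the same power of q, the exponent is [m (m + 1) / 2], and the sum over
   [m + n = j] is the coefficient of [z^j] in
   [prod_(1<=i<=M) (1 + z q^i) * (1 + z) / (z^2; q^2)_(M+1)],
   which equals [1 / (z; q)_(M+1)]. For [M < 0] everything vanishes except the
   empty partition, which the term [chi] accounts for. *)
Require Import Defs.
From mathcomp Require Import all_boot all_order all_algebra.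
From mathcomp Require Import zify ring.
Import Order.TTheory GRing.Theory Num.Theory.
Local Open Scope ring_scope.

(** * Gauss binomials and their Pascal rules *)

Section GaussBinomial.

Variables (F : fieldType) (p : F).
Hypothesis p_neq_root1 : forall i : nat, p ^+ i.+1 != 1.

(** The Gauss binomial [M + j choose j]_p, the coefficient of z^j in 1 / (z; p)_(M+1). This indexing
    makes it symmetric in [M] and [j]. *)
Definition gauss (M j : nat) : F :=
  qpoch p p (M + j) / (qpoch p p j * qpoch p p M).

Lemma qpochS (a : F) (n : nat) :
  qpoch a p n.+1 = qpoch a p n * (1 - a * p ^+ n).
Proof. by rewrite /qpoch big_ord_recr. Qed.

Lemma qpoch_neq0 (n : nat) : qpoch p p n != 0.
Proof.
apply/prodf_neq0 => i _.
by rewrite -exprS subr_eq0 eq_sym p_neq_root1.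
Qed.

Lemma gaussC (M j : nat) : gauss M j = gauss j M.
Proof. by rewrite /gauss addnC [X in _ / X]mulrC. Qed.

Lemma gauss0 (M : nat) : gauss M 0 = 1.
Proof.
by rewrite /gauss addn0 {2}/qpoch big_ord0 mul1r divff ?qpoch_neq0.
Qed.

Lemma gaussS (M j : nat) :
  gauss M.+1 j.+1 = gauss M j.+1 + p ^+ M.+1 * gauss M.+1 j.
Proof.
rewrite /gauss addSn addnS addSn -addnS !qpochS.
have jS : 1 - p * p ^+ j != 0 by rewrite -exprS subr_eq0 eq_sym.
have MS : 1 - p * p ^+ M != 0 by rewrite -exprS subr_eq0 eq_sym.
rewrite addnS qpochS exprS exprS exprD.
by field; rewrite jS MS !qpoch_neq0.
Qed.

Lemma gaussSr (M j : nat) :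
  gauss M.+1 j.+1 = gauss M.+1 j + p ^+ j.+1 * gauss M j.+1.
Proof. by rewrite gaussC gaussS gaussC [gauss j.+1 M]gaussC. Qed.

Lemma qbinom_gauss (M j : nat) :
  qbinom p (M%:Z + j%:Z) j%:Z = gauss M j.
Proof.
rewrite /qbinom addrK ifT; last by lia.
by rewrite -PoszD.
Qed.

Lemma qbinom_nat0 (M : nat) : qbinom p M%:Z 0%:Z = 1.
Proof. by rewrite -[M%:Z]addr0 qbinom_gauss gauss0. Qed.

Lemma qbinom_small (A B : int) : A < B -> qbinom p A B = 0.
Proof. by move=> AB; rewrite /qbinom [B <= A]leNgt AB andbF. Qed.

(* The factor [p ^+ m.+1] avoids the exponent [M - m] of the Pascal rule. *)
Lemma qbinom_natS (M m : nat) :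
  qbinom p M.+1%:Z m.+1%:Z * p ^+ m.+1
  = qbinom p M%:Z m.+1%:Z * p ^+ m.+1 + p ^+ M.+1 * qbinom p M%:Z m%:Z.
Proof.
have [Mm|mM] := ltnP M m.
  by rewrite !qbinom_small ?mul0r ?mulr0 ?addr0 //; lia.
move: (subnK mM); set d := (M - m)%N => <-.
case: d => [|d].
  rewrite add0n [qbinom _ m%:Z m.+1%:Z]qbinom_small ?ltz_nat //.
  have e a : qbinom p a%:Z a%:Z = 1.
    by rewrite -{1}[a]add0n PoszD qbinom_gauss gaussC gauss0.
  by rewrite !e; ring.
have -> : (d.+1 + m).+1%:Z = d.+1%:Z + m.+1%:Z by lia.
have -> : (d.+1 + m)%:Z = d%:Z + m.+1%:Z by lia.
rewrite {2}(_ : d%:Z + m.+1%:Z = d.+1%:Z + m%:Z); last by lia.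
by rewrite !qbinom_gauss gaussS -addnS exprD; ring.
Qed.

End GaussBinomial.

Arguments gauss {F}.

(** * Cauchy products of coefficient sequences *)

Section Convolution.

Variable R : comNzRingType.
Implicit Types a b : nat -> R.

Definition conv a b (j : nat) : R := \sum_(i < j.+1) a i * b (j - i)%N.

(** Multiplication by z on the generating function of [a]. *)
Definition shift a (j : nat) : R := if j is i.+1 then a i else 0.

Lemma convC a b : conv a b =1 conv b a.
Proof.
move=> j; rewrite /conv (reindex_inj rev_ord_inj) /=.
apply: eq_bigr => i _; rewrite subSS subKn; first exact: mulrC.
by rewrite -ltnS ltn_ord.
Qed.

Lemma conv_shift a b : conv (shift a) b =1 shift (conv a b).
Proof.
case=> [|j]; first by rewrite /conv big_ord1 mul0r.
rewrite /conv big_ord_recl /= mul0r add0r.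
by apply: eq_bigr => i _; rewrite subSS.
Qed.

Lemma conv_linear c a1 a2 a b :
  (forall i, a i = a1 i + c * a2 i) ->
  forall j, conv a b j = conv a1 b j + c * conv a2 b j.
Proof.
move=> h j; rewrite /conv mulr_sumr -big_split.
by apply: eq_bigr => i _; rewrite h mulrDl mulrA.
Qed.

End Convolution.

Arguments conv {R}.
Arguments shift {R}.

(** * The product identity behind the sum over m + n = j *)

Section Identity.

Variables (F : fieldType) (q : F).
Hypothesis q_neq_root1 : forall i : nat, q ^+ i.+1 != 1.

Let q2_neq_root1 (i : nat) : (q ^+ 2) ^+ i.+1 != 1.
Proof. by rewrite -exprM mulnS q_neq_root1. Qed.

(** By the q-binomial theorem, the coefficient of z^m in prod_(1<=i<=M) (1 + z q^i). *)
Definition distinct_coef (M m : nat) : F :=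
  q ^+ 'C(m.+1, 2) * qbinom q M%:Z m%:Z.

(** The coefficient of z^n in (1 + z) / (z^2; q^2)_(M+1): the factor 1 + z copies each even
    coefficient to the next odd index, hence the halving. *)
Definition doubled_coef (M n : nat) : F := gauss (q ^+ 2) M n./2.

Lemma distinct_coefS (M m : nat) :
  distinct_coef M.+1 m
  = distinct_coef M m + q ^+ M.+1 * shift (distinct_coef M) m.
Proof.
case: m => [|m].
  by rewrite /distinct_coef /= mulr0 addr0 !qbinom_nat0.
rewrite /distinct_coef /= binS bin1 exprD.
transitivity (q ^+ 'C(m.+1, 2) * (qbinom q M.+1%:Z m.+1%:Z * q ^+ m.+1)).
  by ring.
by rewrite qbinom_natS //; ring.
Qed.

Lemma doubled_coefS (M n : nat) :
  doubled_coef M n = doubled_coef M.+1 n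
    + - (q ^+ M.+1) ^+ 2 * shift (shift (doubled_coef M.+1)) n.
Proof.
rewrite /doubled_coef; case: n => [|[|n]] /=.
- by rewrite !gauss0 // mulr0 addr0.
- by rewrite !gauss0 // mulr0 addr0.
by rewrite gaussS // -!exprM [(2 * _)%N]mulnC; ring.
Qed.

(* With [E_M = prod_(1<=i<=M) (1 + z q^i)], [G_M = (1 + z) / (z^2; q^2)_(M+1)]
   and [H_M = 1 / (z; q)_(M+1)], this is the coefficientwise form of
   [E_M G_M = H_M]. Both sides satisfy [(1 - z q^(M+1)) H_(M+1) = H_M]. *)
Lemma gauss_conv (M j : nat) :
  conv (distinct_coef M) (doubled_coef M) j = gauss q M j.
Proof.
elim: M j => [|M IHM] j.
  (* Here E_0 = 1 and G_0 = (1 + z) / (1 - z^2) = 1 / (1 - z), so every coefficient is 1. *)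
  rewrite gaussC gauss0 // /conv big_ord_recl big1 => [|i _].
    rewrite /distinct_coef /doubled_coef subn0 gaussC gauss0 // mulr1 /=.
    by rewrite /= qbinom_nat0 // mul1r addr0.
  by rewrite /distinct_coef qbinom_small // mulr0 mul0r.
(* [A] stands for E_M G_(M+1). Multiplying it by 1 + z q^(M+1) gives E_(M+1) G_(M+1) ([up]), and by
   1 - z^2 q^(2M+2) gives H_M ([down]); the two differ by the factor 1 - z q^(M+1). *)
set A := conv (distinct_coef M) (doubled_coef M.+1).
have up i : conv (distinct_coef M.+1) (doubled_coef M.+1) i
    = A i + q ^+ M.+1 * shift A i.
  by rewrite (conv_linear _ _ _ _ _ _ (distinct_coefS M)) conv_shift.
have down i : gauss q M i
    = A i + - (q ^+ M.+1) ^+ 2 * shift (shift A) i.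
  rewrite -IHM convC (conv_linear _ _ _ _ _ _ (doubled_coefS M)) convC.
  congr (_ + _ * _); rewrite conv_shift; case: i => //= i.
  by rewrite conv_shift; case: i => //= i; rewrite convC.
rewrite up; elim: j => [|j IHj].
  by rewrite gauss0 // -(gauss0 _ _ q_neq_root1 M) down /= !mulr0.
by rewrite gaussS // -IHj down /=; ring.
Qed.

End Identity.

(** * Partitions with a fixed number of parts and their generating function *)

Section Partitions.

Variables (k N : nat).

Fixpoint UG_enum (l j : nat) : seq (seq nat) :=
  if j is j'.+1 then
    [seq a :: pi | a <- iota l (N.+1 - l), pi <- UG_enum (a + k) j']
  else [:: [::]].

(** The gap condition implies sortedness and [0 < l] gives positivity of [a], so only the three
    bounds remain. *)
Lemma UG_cons (l a : nat) (pi : seq nat) : (0 < l)%N ->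
  UG k l N (a :: pi) = [&& (l <= a)%N, (a <= N)%N & UG k (a + k) N pi].
Proof.
move=> l_gt0; rewrite /UG /is_partition /=.
case: pi => [|b pi] /=; first by lia.
case: (path leq b pi); case: (path _ b pi); case: (all _ pi);
  case: (all _ pi); lia.
Qed.

Lemma mem_UG_enum (l j : nat) (pi : seq nat) : (0 < l)%N ->
  (pi \in UG_enum l j) = (size pi == j) && UG k l N pi.
Proof.
elim: j l pi => [|j IHj] l [|a pi] l_gt0 //=.
  by apply/allpairsPdep => -[? [? []]].
rewrite UG_cons // eqSS; apply/allpairsPdep/idP => [[b [mu []]]|].
  rewrite mem_iota => lb hmu [-> ->]; move: hmu.
  rewrite IHj; last by lia.
  by move=> /andP[-> ->]; lia.
move=> /and4P[sz la aN ug]; exists a, pi.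
have ak : (0 < a + k)%N by lia.
by rewrite mem_iota IHj // sz ug; split=> //; lia.
Qed.

Lemma UG_enum_uniq (l j : nat) : uniq (UG_enum l j).
Proof.
elim: j l => [|j IHj] l //=.
apply: allpairs_uniq_dep => [|a _|[a mu] [b nu] _ _ /= [-> ->]] //.
exact: iota_uniq.
Qed.

Variables (F : fieldType) (q : F).
Hypothesis q_neq_root1 : forall i : nat, q ^+ i.+1 != 1.

Definition UG_gf (l j : nat) : F := \sum_(pi <- UG_enum l j) q ^+ sumn pi.

(** Either the smallest part is [l], and removing it raises the bound to [l + k], or all parts are
    at least [l.+1]. *)
Lemma UG_gfS (l j : nat) :
  UG_gf l j.+1 =
  if (l <= N)%N then q ^+ l * UG_gf (l + k) j + UG_gf l.+1 j.+1 else 0.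
Proof.
have e i : UG_gf i j.+1 = \sum_(i <= a < N.+1) q ^+ a * UG_gf (a + k) j.
  rewrite /UG_gf /= big_allpairs_dep; apply: eq_bigr => a _.
  by rewrite mulr_sumr; apply: eq_bigr => pi _; rewrite exprD.
rewrite !e; case: leqP => h; first by rewrite big_ltn.
by rewrite big_geq.
Qed.

Lemma UG_gfE (l j : nat) :
  UG_gf l j.+1 = q ^+ (j.+1 * l + k * 'C(j.+1, 2))
    * qbinom q (N%:Z - l%:Z - j%:Z * k%:Z + j.+1%:Z) j.+1%:Z.
Proof.
(* The outer induction is on the number of parts, the inner one on the number of values from [l] to
   [N]. *)
elim: j l => [|j IHj] l; have [d] := ubnP (N.+1 - l);
  elim: d l => // d IHd l ld; rewrite UG_gfS; case: leqP => lN;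
  try by rewrite qbinom_small ?mulr0 //; nia.
  rewrite IHd; last by lia.
  rewrite /UG_gf big_seq1 /= expr0.
  have -> : N%:Z - l%:Z - 0%:Z * k%:Z + 1%:Z = (N - l)%:Z + 1%:Z by lia.
  rewrite qbinom_gauss mul0r subr0 bin_small // muln0 !addn0 !mul1n.
  case e : (N - l)%N => [|c].
    rewrite qbinom_small; last by lia.
    by rewrite mulr0 addr0 gaussC gauss0.
  have -> : N%:Z - l.+1%:Z + 1%:Z = c%:Z + 1%:Z by lia.
  by rewrite qbinom_gauss gaussSr // gauss0 // exprS; ring.
rewrite IHd; last by lia.
rewrite IHj.
have e1 : (l + (j.+1 * (l + k) + k * 'C(j.+1, 2)) =
           j.+2 * l + k * 'C(j.+2, 2))%N.
  by rewrite [in RHS]binS bin1; nia.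
have e2 : (j.+2 * l.+1 + k * 'C(j.+2, 2) =
           j.+2 * l + k * 'C(j.+2, 2) + j.+2)%N by lia.
set w := (j.+2 * l + k * _)%N in e1 e2 *.
rewrite mulrA -exprD e1 e2 exprD -mulrA -mulrDr; congr (_ * _).
have -> : N%:Z - (l + k)%N%:Z - j%:Z * k%:Z + j.+1%:Z =
          N%:Z - l%:Z - j.+1%:Z * k%:Z + j.+1%:Z by nia.
have -> : N%:Z - l.+1%:Z - j.+1%:Z * k%:Z + j.+2%:Z =
          N%:Z - l%:Z - j.+1%:Z * k%:Z - 1 + j.+2%:Z by lia.
(* At 0 the binomial for [l.+1] vanishes and the other two are 1; above 0 this is the Pascal rule
   [gaussSr]; below 0 all three vanish. *)
case: (N%:Z - l%:Z - j.+1%:Z * k%:Z) => [[|M]|M].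
- rewrite [X in _ + _ * X]qbinom_small; last by lia.
  by rewrite mulr0 addr0 !qbinom_gauss ![gauss _ 0 _]gaussC !gauss0.
- have -> : M.+1%:Z - 1 = M%:Z by lia.
  by rewrite !qbinom_gauss -gaussSr.
by rewrite !qbinom_small ?mulr0 ?addr0 //; lia.
Qed.

End Partitions.

(** * The indeterminate q, the exponents, and the comparison of coefficients *)

Lemma qvar_neq_root1 (i : nat) : qvar ^+ i.+1 != 1.
Proof.
rewrite /qvar -tofracXn -tofrac1 tofrac_eq.
apply/eqP => /(congr1 (fun r : {poly rat} => size r)).
by rewrite size_polyXn size_poly1.
Qed.

Lemma divz_bin2 (n : nat) : ((n%:Z * (n%:Z - 1)) %/ 2)%Z = 'C(n, 2)%:Z.
Proof.
rewrite bin2; case: n => [|n] //=.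
have -> : n.+1%:Z * (n.+1%:Z - 1) = (n.+1 * n)%N%:Z by nia.
by rewrite -divn2; lia.
Qed.

(** The terms in [k] combine because C(n, 2) + (n - 1) m + C(m + 1, 2) = C(m + n, 2); apart from C(m
    + 1, 2), the exponent depends only on m + n. *)
Lemma QexpE (k l m n : nat) :
  Qexp k%:Z l%:Z m%:Z n%:Z =
  ((m + n) * l + k * 'C(m + n, 2) + 'C(m.+1, 2))%N%:Z.
Proof.
rewrite /Qexp divz_bin2.
have -> : m%:Z * (m%:Z + 1) = m.+1%:Z * (m.+1%:Z - 1) by lia.
rewrite divz_bin2.
have h a : ('C(a, 2)%:Z * 2 = a%:Z * (a%:Z - 1)).
  elim: a => [|a]; first by rewrite bin0n.
  by rewrite binS bin1; lia.
have := h (m + n)%N; have := h m.+1; have := h n; nia.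
Qed.

Theorem theorem2p6 (N k l : nat) (hl : (0 < l)%N) :
  exists S T : fps ratfun,
    [/\ fps_sum (UG k l N)
          (fun pi : seq nat => fps_monomial (qvar ^+ sumn pi) (size pi)) S,
        fps_sum predT
          (fun mn : nat * nat =>
             let (m, n) := mn in
             fps_monomial
               (qvar ^ Qexp k%:Z l%:Z m%:Z n%:Z
                * qbinom qvar
                    (N%:Z - (l%:Z + (n%:Z - 1) * k%:Z + m%:Z * (k%:Z + 1)) + m%:Z)
                    m%:Z
                * qbinom (qvar ^+ 2)
                    (N%:Z - (l%:Z + (n%:Z - 1) * k%:Z) - k%:Z * m%:Z + (n./2)%:Z)
                    (n./2)%:Z)
               (m + n)%N) T
      & S =1 fps_add T
               (fps_monomial (0 <= N%:Z < l%:Z - k%:Z)%R%:R 0)].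
Proof.
(* The slack between [N] and the largest part of the minimal partition with [j] parts. It is an
   integer since its sign matters. *)
pose M j := N%:Z - l%:Z - (j%:Z - 1) * k%:Z.
exists (UG_gf k N _ qvar l).
exists (fun j : nat => qvar ^+ (j * l + k * 'C(j, 2)) * \sum_(m < j.+1)
  qvar ^+ 'C(m.+1, 2) * qbinom qvar (M j) m%:Z
  * qbinom (qvar ^+ 2) (M j + ((j - m)./2)%:Z) ((j - m)./2)%:Z).
split.
- move=> j; exists (UG_enum k N l j); split.
  + exact: UG_enum_uniq.
  + by apply/allP => pi; rewrite mem_UG_enum // => /andP[].
  + move=> pi ug; rewrite mem_UG_enum // ug andbT /fps_monomial eq_sym.
    by move=> /negbTE ->.
  + apply: eq_big_seq => pi; rewrite mem_UG_enum // => /andP[/eqP <- _].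
    by rewrite /fps_monomial eqxx.
- move=> j; exists [seq (m, (j - m)%N) | m <- iota 0 j.+1]; split.
  + by rewrite map_inj_uniq ?iota_uniq // => a b [].
  + by apply/allP.
  + move=> [m n] _ h; rewrite /fps_monomial; case: eqP => // jmn.
    case/negP: h; apply/mapP; exists m; first by rewrite mem_iota; lia.
    by rewrite jmn addKn.
  + rewrite big_map -[iota 0 j.+1]/(index_iota 0 j.+1) big_mkord mulr_sumr.
    apply: eq_bigr => m _; have mj : (m <= j)%N by rewrite -ltnS.
    rewrite /fps_monomial subnKC // eqxx QexpE subnKC // -exprnP.
    rewrite [in RHS]exprD -!mulrA.
    congr (_ * (_ * (qbinom _ _ _ * qbinom _ _ _))); rewrite /M; nia.
move=> j; rewrite /fps_add.
have conv_nat i (D : nat) : M i = D%:Z ->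
    \sum_(m < i.+1) qvar ^+ 'C(m.+1, 2) * qbinom qvar (M i) m%:Z
      * qbinom (qvar ^+ 2) (M i + ((i - m)./2)%:Z) ((i - m)./2)%:Z
    = gauss qvar D i.
  move=> ->; rewrite -gauss_conv; last exact: qvar_neq_root1.
  by apply: eq_bigr => m _; rewrite qbinom_gauss.
have conv_neg i : M i < 0 ->
    \sum_(m < i.+1) qvar ^+ 'C(m.+1, 2) * qbinom qvar (M i) m%:Z
      * qbinom (qvar ^+ 2) (M i + ((i - m)./2)%:Z) ((i - m)./2)%:Z = 0.
  move=> Mi; apply: big1 => m _.
  by rewrite [X in _ * X * _]qbinom_small ?mulr0 ?mul0r //; lia.
(* For [j = 0] the left side is 1, from the empty partition, and [M 0] is N - l + k, which is
   negative exactly when chi is 1. *)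
case: j => [|j].
  rewrite /UG_gf big_seq1 expr0 /fps_monomial eqxx mul0n bin0n muln0 expr0 mul1r.
  have [lk|lk] := ltP N%:Z (l%:Z - k%:Z).
    by rewrite conv_neg ?add0r //; rewrite /M; lia.
  rewrite (conv_nat _ (N + k - l)%N) ?gauss0 ?addr0 //; last by rewrite /M; lia.
  exact: qvar_neq_root1.
rewrite /fps_monomial /= addr0 UG_gfE; last exact: qvar_neq_root1.
have -> : N%:Z - l%:Z - j%:Z * k%:Z = M j.+1 by rewrite /M; lia.
congr (_ * _); case eM : (M j.+1) => [D|D]; rewrite -eM.
  by rewrite (conv_nat _ D) // eM qbinom_gauss.
by rewrite conv_neg ?qbinom_small //; lia.
Qed.
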